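(* Let $\mathcal{U}$ be a real Hilbert space, let $C_1,\ldots,C_N$ be closed and convex subsets of $\mathcal{U}$, and let $P_{C_i}$ be the projection operator onto $C_i$ for $i=1,\ldots,N$. Let $\lambda_1,\ldots,\lambda_N\in(0,1)$ with $\sum_{i=1}^N\lambda_i=1$, let $u^{(0)}\in\mathcal{U}$ be an initial point, and let $\{u^{(k)}\}$ be the sequence generated by $$u^{(k+1)}=\sum_{i=1}^N\lambda_i P_{C_i}u^{(k)},\qquad k=0,1,2,\ldots.$$ If $\bigcap_{i=1}^N C_i\neq\emptyset$, then $\{u^{(k)}\}$ converges weakly to a point $u^*\in\bigcap_{i=1}^N C_i$. Moreover, if (in addition) all the $C_i$ are closed affine subspaces of $\mathcal{U}$, then $\{u^{(k)}\}$ converges to $u^*$ in norm.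
   Context: For a nonempty closed convex subset $C$ of a Hilbert space $\mathcal{U}$, the projection $P_C u$ is the unique point of $C$ closest to $u$ in norm. An affine subspace is a translate of a linear subspace. *)

(* Defs.v *)
From HB Require Import structures.
From mathcomp Require Import all_boot all_order all_algebra.
From mathcomp Require Import all_classical all_reals all_analysis.

Set Implicit Arguments.
Unset Strict Implicit.
Unset Printing Implicit Defensive.

Import Order.TTheory GRing.Theory Num.Theory.
Import numFieldNormedType.Exports.

Local Open Scope classical_set_scope.
Local Open Scope ring_scope.

(* A real Hilbert space is a complete normed module U over R : realType together
   with an inner product dot : {dot U for idfun} (a symmetric, positive definite
   bilinear form) that induces the norm of U. *)
Definition induces_norm (R : realType) (U : normedModType R)
    (dot : {dot U for (@idfun R)}) : Prop :=
  forall x : U, `|x| = Num.sqrt (dot x x).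

Section HilbertNotions.
Context (R : realType) (U : normedModType R).
Implicit Types (C : set U) (u p : U).

Definition closest_point C u : set U :=
  [set p | C p /\ forall q, C q -> `|u - p| <= `|u - q|].

(* The default value 0 is taken only if no closest point exists, which does not
   happen when C is nonempty, closed and convex and U is a Hilbert space; the
   closest point is then also unique. *)
Definition metric_proj C u : U := xget 0 (closest_point C u).

Definition affine_subspace C : Prop :=
  exists (a : U) (V : set U), submod_closed (mem V) /\ C = [set a + v | v in V].

(* Convergence of a sequence for the weak topology, that is, the topology
   induced by the continuous linear functionals; R^o is R as a module over
   itself. *)
Definition weakly_cvg (u_ : nat -> U) (x : U) : Prop :=
  forall f : {linear U -> R^o}, continuous f -> f (u_ k) @[k --> \oo] --> f x.

End HilbertNotions.

(* Main.v *)
Require Import Defs.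
From HB Require Import structures.
From mathcomp Require Import all_boot all_order all_algebra.
From mathcomp Require Import all_classical all_reals all_analysis.
From mathcomp Require Import ring lra.

(** Write P_i for the projection onto C_i and T u for the average of the P_i u
    with weights lambda_i, so that u_(k+1) = T u_k, and let c be a common point.

    Weak convergence. The variational inequality <u - P_i u, c - P_i u> <= 0
    gives |P_i u - c|^2 + |u - P_i u|^2 <= |u - c|^2; averaging over i with the
    convexity of the squared norm shows that |u_k - c|^2 drops at each step by
    at least the average of the |u_k - P_i u_k|^2 ([average_proj_fejer]).
    Hence |u_k - c| converges for every common point c, and u_k - P_i u_k tends
    to 0 for every i. As a closed convex set is weakly closed, every weak
    cluster point of the u_k lies in all the C_i ([weak_limit_closed_convex]).
    Opial's argument then allows only one cluster point: for common points z
    and w, <u_k, z - w> is an affine function of |u_k - z|^2 - |u_k - w|^2, so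
    it converges, and comparing its limits along two ultrafilters whose weak
    limits are z and w gives <z, z - w> = <w, z - w>, that is z = w ([opial]).
    Weak cluster points exist because the limit of <u_k, y> along an
    ultrafilter is a bounded linear functional of y, which Riesz' theorem
    represents; this replaces weak sequential compactness.

    Norm convergence. If the C_i are affine, then u |-> T (c + u) - c is a
    linear self-adjoint map with values of <T u - c, u - c> between
    |T u - c|^2 and |u - c|^2. Self-adjointness makes <u_j - c, u_k - c> depend
    on j + k only; call it a_(j+k). The bounds make a nonincreasing, hence
    convergent, and
      |u_j - u_k|^2 = a_(2j) - 2 a_(j+k) + a_(2k)
    then shows that u is a Cauchy sequence ([iter_affine_cvg]). Its limit is
    the weak limit. *)

Set Implicit Arguments.
Unset Strict Implicit.

Import Order.TTheory GRing.Theory Num.Theory.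
Import numFieldNormedType.Exports.

Local Open Scope classical_set_scope.
Local Open Scope ring_scope.

(** * Inner product and norm *)

Section InnerProduct.
Context (R : realType) (U : normedModType R) (dot : {dot U for (@idfun R)})
  (dot_norm : induces_norm dot).
Implicit Types (x y z : U).

Lemma dotC x y : dot x y = dot y x.
Proof. by rewrite hermC /= expr0 mul1r. Qed.

Lemma dot0l z : dot 0 z = 0.
Proof. by rewrite dotC linear0r. Qed.

Lemma dotBl x y z : dot (x - y) z = dot x z - dot y z.
Proof. by rewrite dotC linearBr/= (dotC z x) (dotC z y). Qed.

Lemma dotZl a x z : dot (a *: x) z = a * dot x z.
Proof. by rewrite dotC linearZr_LR /= dotC. Qed.

Lemma dotBr x y z : dot z (x - y) = dot z x - dot z y.
Proof. exact: linearBr. Qed.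

Lemma dotDr x y z : dot z (x + y) = dot z x + dot z y.
Proof. exact: linearDr. Qed.

Lemma dotZr a x z : dot z (a *: x) = a * dot z x.
Proof. by rewrite dotC dotZl dotC. Qed.

Lemma dot_suml (I : finType) (F : I -> U) z :
  dot (\sum_i F i) z = \sum_i dot (F i) z.
Proof. by rewrite dotC linear_sumr; apply: eq_bigr => i _; rewrite dotC. Qed.

Lemma dotxx x : dot x x = `|x| ^+ 2.
Proof.
have [->|x0] := eqVneq x 0; first by rewrite dot0l normr0 expr0n.
by rewrite dot_norm sqr_sqrtr ?ltW ?neq0_dnorm_gt0.
Qed.

Lemma norm2B x y : `|x - y| ^+ 2 = `|x| ^+ 2 - 2 * dot x y + `|y| ^+ 2.
Proof. rewrite -!dotxx dotBl !dotBr (dotC y x); ring. Qed.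

Lemma norm2D x y : `|x + y| ^+ 2 = `|x| ^+ 2 + 2 * dot x y + `|y| ^+ 2.
Proof. rewrite -[y in LHS]opprK norm2B normrN -(scaleN1r y) dotZr; ring. Qed.

Lemma parallelogram x y :
  `|x - y| ^+ 2 = 2 * `|x| ^+ 2 + 2 * `|y| ^+ 2 - `|x + y| ^+ 2.
Proof. rewrite norm2B norm2D; ring. Qed.

(** Expand | |y| x - |x| y |^2 >= 0 and cancel the factor |x| |y|. *)
Lemma dot_le x y : dot x y <= `|x| * `|y|.
Proof.
have := sqr_ge0 `| `|y| *: x - `|x| *: y |.
rewrite norm2B !normrZ !normr_id dotZl dotZr => h.
have [->|x0] := eqVneq x 0; first by rewrite dot0l normr0 mul0r.
have [->|y0] := eqVneq y 0; first by rewrite linear0r normr0 mulr0.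
have p0 : 0 < `|x| * `|y| by rewrite mulr_gt0 ?normr_gt0.
rewrite -(ler_pM2l p0); lra.
Qed.

Lemma cauchy_schwarz x y : `|dot x y| <= `|x| * `|y|.
Proof.
rewrite ler_norml dot_le andbT -(normrN x) lerNl.
by apply: le_trans (dot_le _ _); rewrite -(scaleN1r x) dotZl mulN1r.
Qed.

Lemma cvg_dotl (T : Type) (F : set_system T) (FF : Filter F)
    (f : T -> U) x y :
  f t @[t --> F] --> x -> dot (f t) y @[t --> F] --> dot x y.
Proof.
move=> /cvgrPdist_lt fx; apply/cvgrPdist_lt => e e0.
have d0 : 0 < e / (`|y| + 1) by rewrite divr_gt0// ltr_pwDr.
move: (fx _ d0); apply: filterS => t xt.
rewrite -dotBl (le_lt_trans (cauchy_schwarz _ _))//.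
apply: (@le_lt_trans _ _ (`|x - f t| * (`|y| + 1))).
  by rewrite ler_wpM2l// lerDl.
by rewrite -ltr_pdivlMr// ltr_pwDr.
Qed.

End InnerProduct.

(** The form in which both Cauchy arguments below arise: minimizing sequences
    through the parallelogram law, and iterates of a self-adjoint map. *)
Lemma cvgn_cauchy_bound (R : realType) (U : completeNormedModType R)
    (x : nat -> U) (e : nat -> R) :
  e n @[n --> \oo] --> 0 ->
  (forall m n, `|x m - x n| ^+ 2 <= e m + e n) -> cvgn x.
Proof.
move=> e0 xe; apply/cauchy_cvgP/cauchyP => r r0.
have r2 : 0 < r ^+ 2 / 2 by rewrite divr_gt0// exprn_gt0.
have [N _ HN] := cvgr0_norm_lt _ e0 _ r2.
exists (x N); exists N => // n Nn /=.
rewrite -ball_normE /ball_ /= -(ltr_pXn2r (ltn0Sn 1)) ?nnegrE// ?ltW//.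
apply: le_lt_trans (xe _ _) _.
have /= := HN _ (leqnn N); have /= := HN _ Nn; rewrite !ltr_norml; lra.
Qed.

(** * Projection onto a closed convex set *)

Lemma convex_set_segment (R : realType) (U : lmodType R) (C : set U)
    (t : R) (x y : U) :
  convex_set C -> C x -> C y -> 0 <= t -> t <= 1 -> C (x + t *: (y - x)).
Proof.
move=> Ccvx Cx Cy t0 t1.
have h : C (t *: y + (1 - t) *: x).
  by have := Ccvx y x (Itv01 t0 t1); rewrite !inE; apply.
suff -> : x + t *: (y - x) = t *: y + (1 - t) *: x by [].
by rewrite scalerBr scalerBl scale1r addrCA.
Qed.

Section Projection.
Context (R : realType) (U : normedModType R) (dot : {dot U for (@idfun R)})
  (dot_norm : induces_norm dot).
Implicit Types (C : set U) (u p q : U).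

(** The variational inequality of the projection: moving from p towards q by a
    small step t changes |u - p|^2 by -2 t <u - p, q - p> + t^2 |q - p|^2, which
    cannot be negative. *)
Lemma closest_point_dot_le0 C u p q :
  convex_set C -> closest_point C u p -> C q -> dot (u - p) (q - p) <= 0.
Proof.
move=> Ccvx [Cp pmin] Cq; rewrite leNgt; apply/negP => s0.
set s := dot _ _ in s0; pose b := `|q - p| ^+ 2.
have b0 : 0 <= b by rewrite sqr_ge0.
have sb : 0 < s + b by rewrite ltr_pwDl.
(* With s = <u - p, q - p> > 0 and b = |q - p|^2, this step gives t b < 2 s. *)
pose t := s / (s + b).
have t0 : 0 < t by rewrite divr_gt0.
have t1 : t <= 1 by rewrite ler_pdivrMr// mul1r lerDl.
have Ct := convex_set_segment Ccvx Cp Cq (ltW t0) t1.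
have := pmin _ Ct; rewrite -(ler_pXn2r (ltn0Sn 1)) ?nnegrE//.
rewrite opprD addrA (norm2B dot_norm (u - p)) (dotZr _) normrZ exprMn.
rewrite -/s -/b real_normK ?num_real// => h.
have {h} : t * (2 * s) <= t * (t * b) by lra.
rewrite ler_pM2l// => h.
have : t * (s + b) = s by rewrite /t divfK ?gt_eqF.
have := mulr_gt0 t0 s0; lra.
Qed.

End Projection.

(** For p and q in C the midpoint is in C, so the parallelogram law bounds
    |p - q|^2 by the excesses of |u - p|^2 and |u - q|^2 over their infimum on C:
    a minimizing sequence is Cauchy. *)
Lemma closest_point_exists (R : realType) (U : completeNormedModType R)
    (dot : {dot U for (@idfun R)}) (dot_norm : induces_norm dot)
    (C : set U) (u : U) :
  closed C -> convex_set C -> C !=set0 -> closest_point C u !=set0.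
Proof.
move=> Ccl Ccvx [c0 Cc0].
pose E := [set `|u - q| ^+ 2 | q in C]; pose d := inf E.
have Elb : has_lbound E by exists 0 => _ [q _ <-]; rewrite sqr_ge0.
have E0 : E !=set0 by exists (`|u - c0| ^+ 2), c0.
have dle q : C q -> d <= `|u - q| ^+ 2 by move=> Cq; apply: ge_inf => //; exists q.
have /choice[q qP] : forall n, exists q, C q /\ `|u - q| ^+ 2 < d + harmonic n :> R.
  move=> n; have := inf_adherent (@harmonic_gt0 R n) (conj E0 Elb).
  by move=> [_ [q Cq <-] ?]; exists q.
have e0 : 2 * @harmonic R n @[n --> \oo] --> 0.
  by rewrite -[0](mulr0 2); apply: cvgMl_tmp; exact: cvg_harmonic.
have qq m n : `|q m - q n| ^+ 2 <= 2 * harmonic m + 2 * harmonic n.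
  have [Cm dm] := qP m; have [Cn dn] := qP n.
  have subB x y : u - x - (u - y) = y - x by rewrite opprB addrC addrA subrK.
  have h0 : (0 : R) <= 1 / 2 by lra.
  have h1 : (1 / 2 : R) <= 1 by lra.
  have := dle _ (convex_set_segment Ccvx Cm Cn h0 h1).
  have -> : u - (q m + (1 / 2) *: (q n - q m)) =
            (1 / 2 : R) *: ((u - q m) + (u - q n)).
    rewrite opprD addrA -(subB (q m) (q n)); move: (u - q m) (u - q n) => a b.
    rewrite scalerBr opprB addrCA scalerDr [RHS]addrC; congr (_ + _).
    by rewrite -{1}(scale1r a) -scalerBl; congr (_ *: _); lra.
  rewrite (distrC (q m)) -(subB (q m) (q n)) (parallelogram dot_norm) normrZ exprMn.
  rewrite ger0_norm// => h; lra.
have /cvg_ex[/= p qp] := cvgn_cauchy_bound e0 qq.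
exists p; split.
  by apply: (closed_cvg C _ _ p qp) => //; apply: nearW => n; have [] := qP n.
move=> c /dle dc; rewrite -(ler_pXn2r (ltn0Sn 1)) ?nnegrE//; apply: le_trans dc.
have h : `|u - q n| ^+ 2 @[n --> \oo] --> `|u - p| ^+ 2.
  apply: cvgM; apply: cvg_norm; apply: cvgB => //; exact: cvg_cst.
apply: (ler_cvg_to h (_ : d + harmonic n @[n --> \oo] --> d)).
  by rewrite -[X in _ --> X]addr0; apply: cvgD; [exact: cvg_cst|exact: cvg_harmonic].
by apply: nearW => n; have [_ /ltW] := qP n.
Qed.

Lemma affine_subspace_translate (R : realType) (U : normedModType R)
    (C : set U) (p q q' : U) :
  affine_subspace C -> C p -> C q -> C q' -> C (p + (q - q')).
Proof.
move=> [a [V [[_ Vlin] ->]]] [v Vv <-] [w Vw <-] [w' Vw' <-].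
have VD b x y : V x -> V y -> V (b *: x + y).
  by move=> Vx Vy; have := Vlin b x y; rewrite !inE; apply.
exists (1 *: v + (-1 *: w' + w)); first exact: VD (VD _ _ _ _ _).
rewrite scale1r scaleN1r -addrA; congr (_ + (_ + _)).
by rewrite opprD addrACA subrr add0r addrC.
Qed.

(** Expand the square of (u - p) - (c - p): the variational inequality gives the
    cross term its sign. *)
Lemma closest_point_pythagoras (R : realType) (U : normedModType R)
    (dot : {dot U for (@idfun R)}) (dot_norm : induces_norm dot)
    (C : set U) (u p c : U) :
  convex_set C -> closest_point C u p -> C c ->
  `|p - c| ^+ 2 + `|u - p| ^+ 2 <= `|u - c| ^+ 2.
Proof.
move=> Ccvx up Cc; have := closest_point_dot_le0 dot_norm Ccvx up Cc.
have -> : u - c = (u - p) - (c - p) by rewrite opprB addrA subrK.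
rewrite (norm2B dot_norm (u - p)) (distrC p); lra.
Qed.

(** On an affine subspace the variational inequality at q holds in both
    directions p - c and c - p, so w - q is orthogonal to p - c. Applied twice,
    this is the self-adjointness of the linear part of the projection. *)
Lemma affine_proj_dot (R : realType) (U : normedModType R)
    (dot : {dot U for (@idfun R)}) (dot_norm : induces_norm dot)
    (C : set U) (p w q c : U) :
  convex_set C -> affine_subspace C -> C c -> C p -> closest_point C w q ->
  dot (p - c) (w - c) = dot (p - c) (q - c).
Proof.
move=> Ccvx Caff Cc Cp wq; have [Cq _] := wq.
have le1 := closest_point_dot_le0 dot_norm Ccvx wq
  (affine_subspace_translate Caff Cq Cp Cc).
have le2 := closest_point_dot_le0 dot_norm Ccvx wq
  (affine_subspace_translate Caff Cq Cc Cp).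
have -> : w - c = (w - q) + (q - c) by rewrite addrA subrK.
rewrite dotDr (dotC _ _ (w - q)).
move: le1 le2; rewrite !(addrC q) !addrK -(opprB p) -(scaleN1r (p - c)) dotZr.
lra.
Qed.

(** * Riesz representation and weak limits *)

(** If f is not zero, the closest point p to 0 on the hyperplane f = 1 is
    orthogonal to the kernel of f, and p / |p|^2 represents f. Stating it for a
    bare function lets it apply to pointwise limits of functionals. *)
Lemma riesz (R : realType) (U : completeNormedModType R)
    (dot : {dot U for (@idfun R)}) (dot_norm : induces_norm dot)
    (f : U -> R) :
  scalar f -> continuous f -> exists z, forall y, f y = dot z y.
Proof.
move=> flin fcts.
have fZD a x y : f (a *: x + y) = a * f x + f y by exact: flin.
have f0 : f 0 = 0.
  by have := fZD (-1) 0 0; rewrite scaler0 addr0; lra.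
have fZ a x : f (a *: x) = a * f x by rewrite -[a *: x]addr0 fZD f0 addr0.
have fD x y : f (x + y) = f x + f y by rewrite -{1}[x]scale1r fZD mul1r.
have [fz|] := pselect (forall y, f y = 0).
  by exists 0 => y; rewrite fz dot0l.
move=> /existsNP[w /eqP fw].
pose H := [set x | f x = 1].
have Hcl : closed H.
  by apply: (@preimage_closed _ _ f [set x | x = 1] (in1W fcts)); exact: closed_eq.
have Hcvx : convex_set H.
  move=> x y t; rewrite !inE /H /= => fx fy.
  rewrite [LHS](fZD _ x) fZ fx fy /unstable.onem; lra.
have H0 : H !=set0 by exists ((f w)^-1 *: w); rewrite /H /= fZ mulVf.
have [p pP] := closest_point_exists dot_norm 0 Hcl Hcvx H0.
have fp : f p = 1 by have [] := pP.
have le0 y : f y = 0 -> 0 <= dot p y.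
  move=> fy; have Hq : H (p + y) by rewrite /H /= fD fy fp addr0.
  have := closest_point_dot_le0 dot_norm Hcvx pP Hq.
  by rewrite (addrC p y) addrK dotBl dot0l sub0r oppr_le0.
have eq0 y : f y = 0 -> dot p y = 0.
  move=> fy; apply/eqP; rewrite eq_le le0// andbT -oppr_ge0.
  by have := le0 (-1 *: y); rewrite fZ fy mulr0 dotZr mulN1r; apply.
have p0 : dot p p != 0.
  rewrite (dotxx dot_norm) sqrf_eq0 normr_eq0; apply/eqP => p0.
  by move: fp; rewrite p0 f0 => /esym/eqP; rewrite oner_eq0.
exists ((dot p p)^-1 *: p) => y.
have := eq0 (- f y *: p + y); rewrite fZD fp mulr1 addNr => /(_ erefl).
rewrite dotDr dotZr dotZl => /eqP; rewrite mulNr addrC subr_eq0 => /eqP ->.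
by rewrite mulrC mulfK.
Qed.

(** Each <x t, y> stays in a compact interval, so it has a limit along G; this
    limit is linear in y and bounded by M |y|. *)
Lemma ultra_weak_limit (R : realType) (U : completeNormedModType R)
    (dot : {dot U for (@idfun R)}) (dot_norm : induces_norm dot)
    (T : Type) (G : set_system T) (GU : UltraFilter G) (x : T -> U) (M : R) :
  (forall t, `|x t| <= M) ->
  exists z, forall y, dot (x t) y @[t --> G] --> dot z y.
Proof.
move=> xM.
have GF : ProperFilter G by exact: ultra_proper.
have xyM y t : `|dot (x t) y| <= M * `|y|.
  by apply: le_trans (cauchy_schwarz dot_norm _ _) _; rewrite ler_wpM2r.
have /choice[f fP] : forall y, exists l : R, dot (x t) y @[t --> G] --> l.
  move=> y.
  have Gy : (dot (x t) y @[t --> G]) `[- (M * `|y|), M * `|y|]%classic.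
    by apply: nearW => t /=; rewrite in_itv /= -ler_norml.
  have [l [_ lcl]] := segment_compact _ Gy; exists l.
  move=> A Al; have [//|GnA] := in_ultra_setVsetC ((fun t => dot (x t) y) @^-1` A) GU.
  by have [r [/= nAr Ar]] := lcl (~` A) A GnA Al.
have flin : scalar f.
  move=> a y z.
  have fyz : dot (x t) (a *: y + z) @[t --> G] --> a * f y + f z.
    under eq_fun do rewrite dotDr dotZr.
    by apply: cvgD; [apply: cvgMl_tmp; exact: fP|exact: fP].
  exact: (cvg_unique (@norm_hausdorff _ _) (fP _) fyz).
have fM y : `|f y| <= M * `|y|.
  apply: (@cvgr_to_le _ G _ _ (fun t => `|dot (x t) y|)); last exact: nearW.
  by apply: cvg_norm; exact: fP.
have fcts : continuous f.
  move=> y; apply/cvgrPdist_lt => e e0.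
  have d0 : 0 < e / (`|M| + 1) by rewrite divr_gt0// ltr_pwDr.
  have : \forall w \near y, `|y - w| < e / (`|M| + 1).
    by apply: (cvgr_dist_lt _ _ _ _ d0); exact: cvg_id.
  apply: filterS => w yw.
  have -> : f y - f w = f (y - w).
    by rewrite (addrC y) -scaleN1r flin mulN1r addrC.
  apply: (le_lt_trans (fM _)); move: yw; rewrite ltr_pdivlMr ?ltr_pwDr//.
  apply: le_lt_trans; rewrite mulrC ler_wpM2l//.
  by rewrite (le_trans (ler_norm M))// lerDl.
have [z zP] := riesz dot_norm flin fcts.
by exists z => y; rewrite -zP; exact: fP.
Qed.

(** A filter is the intersection of the ultrafilters containing it: if A is not
    in the image of F, an ultrafilter above F contains the preimage of the
    complement of A. *)
Lemma cvg_ultra (T : Type) (V : topologicalType) (F : set_system T)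
    (FF : Filter F) (f : T -> V) (l : V) :
  (forall G, UltraFilter G -> F `<=` G -> f t @[t --> G] --> l) ->
  f t @[t --> F] --> l.
Proof.
move=> FG A lA; apply: contrapT => nFA.
pose W := within (f @^-1` (~` A)) F.
have WP : ProperFilter W.
  split; last exact: within_filter.
  move=> W0; apply: nFA; apply: (@filterS _ F FF _ _ _ W0) => t /= h.
  by apply: contrapT => /h.
have [G [GU WG]] := ultraFilterLemma WP.
have GF := @ultra_proper _ _ GU.
have FG' : F `<=` G by move=> B FB; apply: WG; apply: filterS FB => t Bt _.
have GA : G (f @^-1` A) by exact: (FG G GU FG' A lA).
have GnA : G (f @^-1` (~` A)) by apply: WG; exact: withinT.
apply: (@filter_not_empty _ G _).
by apply: filterS (filterI GA GnA) => t [].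
Qed.

(** The distances to two points z and w of S determine <u t, z - w> up to a
    constant, so two weak cluster points in S have the same inner product with
    their difference and coincide. *)
Lemma opial (R : realType) (U : completeNormedModType R)
    (dot : {dot U for (@idfun R)}) (dot_norm : induces_norm dot)
    (T : Type) (F : set_system T) (FF : ProperFilter F) (u : T -> U) (M : R)
    (S : set U) :
  (forall t, `|u t| <= M) ->
  (forall c, S c -> cvg (`|u t - c| @[t --> F])) ->
  (forall G z, UltraFilter G -> F `<=` G ->
    (forall y, dot (u t) y @[t --> G] --> dot z y) -> S z) ->
  exists2 z, S z & forall y, dot (u t) y @[t --> F] --> dot z y.
Proof.
move=> uM ucvg clus.
have [G0 [G0U FG0]] := ultraFilterLemma FF.
have [z zP] := ultra_weak_limit dot_norm G0U uM.
have Sz := clus _ _ G0U FG0 zP.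
exists z => // y; apply: cvg_ultra => G GU FG.
have [w wP] := ultra_weak_limit dot_norm GU uM.
have Sw := clus _ _ GU FG wP.
suff -> : z = w by exact: wP.
have G0F := @ultra_proper _ _ G0U; have GF := @ultra_proper _ _ GU.
have /cvg_ex[/= l lP] : cvg (dot (u t) (z - w) @[t --> F]).
  have eqd t : dot (u t) (z - w) =
      2^-1 * (`|z| ^+ 2 - `|w| ^+ 2 - (`|u t - z| ^+ 2 - `|u t - w| ^+ 2)).
    by rewrite !(norm2B dot_norm) dotBr; field.
  under eq_fun do rewrite eqd.
  apply: is_cvgMl_tmp; apply: is_cvgB; first exact: is_cvg_cst.
  by apply: is_cvgB; apply: is_cvgM; exact: ucvg.
have lz : dot z (z - w) = l.
  by apply: (cvg_unique _ (zP _)); [exact: norm_hausdorff|move=> A /lP /FG0].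
have lw : dot w (z - w) = l.
  by apply: (cvg_unique _ (wP _)); [exact: norm_hausdorff|move=> A /lP /FG].
apply/eqP; rewrite -subr_eq0 -normr_eq0 -sqrf_eq0 -(dotxx dot_norm) dotBl lz lw.
by rewrite subrr.
Qed.

Lemma weakly_cvg_dot (R : realType) (U : completeNormedModType R)
    (dot : {dot U for (@idfun R)}) (dot_norm : induces_norm dot)
    (u : nat -> U) (x : U) :
  (forall y, dot (u k) y @[k --> \oo] --> dot x y) -> weakly_cvg u x.
Proof.
move=> ux f fcts.
have flin : scalar f by move=> a y z; rewrite linearP.
have [z zP] := riesz dot_norm flin fcts.
rewrite zP dotC.
under eq_fun do rewrite zP dotC.
exact: ux.
Qed.

(** A closed convex set is weakly closed, in a form that only asks the x t to
    approach the set in norm. With p the projection of z, the inequality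
    <z - p, q t - p> <= 0 passes to the limit as |z - p|^2 <= 0. *)
Lemma weak_limit_closed_convex (R : realType) (U : completeNormedModType R)
    (dot : {dot U for (@idfun R)}) (dot_norm : induces_norm dot) (C : set U)
    (T : Type) (F : set_system T) (FF : ProperFilter F) (x q : T -> U) (z : U) :
  closed C -> convex_set C -> (forall t, C (q t)) ->
  `|x t - q t| @[t --> F] --> 0 ->
  (forall y, dot (x t) y @[t --> F] --> dot z y) -> C z.
Proof.
move=> Ccl Ccvx Cq xq xz.
have [t0 _] : exists t : T, True.
  by have [t _] := filter_ex (@filterT _ F _); exists t.
have [p zp] := closest_point_exists dot_norm z Ccl Ccvx (ex_intro _ _ (Cq t0)).
suff -> : z = p by have [] := zp.
apply/eqP; rewrite -subr_eq0 -normr_eq0 -sqrf_eq0 eq_le sqr_ge0 andbT.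
have lhs : dot (x t) (z - p) - dot p (z - p) @[t --> F] --> `|z - p| ^+ 2.
  by rewrite -(dotxx dot_norm) dotBl; apply: cvgB; [exact: xz|exact: cvg_cst].
have rhs : `|x t - q t| * `|z - p| @[t --> F] --> 0.
  by rewrite -[0](mul0r `|z - p|); apply: cvgMr_tmp.
have diff := cvgB rhs lhs; rewrite -oppr_ge0 -[leRHS]sub0r.
apply: (cvgr_to_ge (diff _)); apply: nearW => t /=; rewrite subr_ge0.
have qp := closest_point_dot_le0 dot_norm Ccvx zp (Cq t).
apply: le_trans (dot_le dot_norm (x t - q t) (z - p)).
have split_at_q : x t - p = (x t - q t) + (q t - p) by rewrite addrA subrK.
by rewrite -dotBl split_at_q dotC dotDr (dotC _ _ (x t - q t)) gerDl.
Qed.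

(** * The averaged projection map *)

Section AveragedProjections.
Context (R : realType) (U : completeNormedModType R)
  (dot : {dot U for (@idfun R)}) (dot_norm : induces_norm dot)
  (N : nat) (C : 'I_N -> set U)
  (C_closed : forall i, closed (C i)) (C_convex : forall i, convex_set (C i))
  (lambda : 'I_N -> R) (lambda_gt0 : forall i, 0 < lambda i)
  (lambda_sum : \sum_(i < N) lambda i = 1)
  (C_meet : \bigcap_(i in [set: 'I_N]) C i !=set0).
Implicit Types (u w c : U).

Let P i u := metric_proj (C i) u.
Let T u := \sum_(i < N) lambda i *: P i u.

Lemma metric_proj_closest i u : closest_point (C i) u (P i u).
Proof.
apply: xgetPex; apply: (closest_point_exists dot_norm) => //.
by have [c Cc] := C_meet; exists c; apply: Cc.
Qed.

Lemma average_subr (x : 'I_N -> U) c :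
  \sum_(i < N) lambda i *: x i - c = \sum_(i < N) lambda i *: (x i - c).
Proof.
under [RHS]eq_bigr do rewrite scalerBr.
by rewrite sumrB -scaler_suml lambda_sum scale1r.
Qed.

(** The difference of the two sides is the variance, the average of the
    |x i - m|^2 with m the mean. *)
Lemma norm2_average_le (x : 'I_N -> U) :
  `|\sum_(i < N) lambda i *: x i| ^+ 2 <= \sum_(i < N) lambda i * `|x i| ^+ 2.
Proof.
set m := \sum_(i < N) _.
have : 0 <= \sum_(i < N) lambda i * `|x i - m| ^+ 2.
  by apply: sumr_ge0 => i _; rewrite mulr_ge0 ?sqr_ge0// ltW.
have -> : \sum_(i < N) lambda i * `|x i - m| ^+ 2 =
    \sum_(i < N) lambda i * `|x i| ^+ 2 - 2 * dot m m + `|m| ^+ 2.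
  have -> : dot m m = \sum_(i < N) lambda i * dot (x i) m.
    by rewrite {1}/m dot_suml; apply: eq_bigr => i _; rewrite dotZl.
  have -> : `|m| ^+ 2 = \sum_(i < N) lambda i * `|m| ^+ 2.
    by rewrite -mulr_suml lambda_sum mul1r.
  rewrite mulr_sumr -sumrB -big_split; apply: eq_bigr => i _ /=.
  rewrite (norm2B dot_norm); ring.
rewrite (dotxx dot_norm); lra.
Qed.

(** Both weak convergence facts about the iterates come from this: the distance
    to a common point decreases, and the residuals |u - P i u| are controlled by
    the decrease. *)
Lemma average_proj_fejer u c : (forall i, C i c) ->
  `|T u - c| ^+ 2 + \sum_(i < N) lambda i * `|u - P i u| ^+ 2 <= `|u - c| ^+ 2.
Proof.
move=> Cc; rewrite /T average_subr.
apply: le_trans (lerD (norm2_average_le _) (lexx _)) _.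
rewrite -big_split -[leRHS]mul1r -lambda_sum mulr_suml.
apply: ler_sum => i _ /=; rewrite -mulrDr ler_wpM2l ?(ltW (lambda_gt0 i))//.
exact: (closest_point_pythagoras dot_norm (@C_convex i) (metric_proj_closest i u)).
Qed.

Lemma average_proj_selfadjoint u w c :
  (forall i, affine_subspace (C i)) -> (forall i, C i c) ->
  dot (T u - c) (w - c) = dot (u - c) (T w - c).
Proof.
move=> Caff Cc; rewrite [RHS]dotC /T !average_subr !dot_suml.
apply: eq_bigr => i _; rewrite !dotZl; congr (_ * _).
have uP := metric_proj_closest i u; have wP := metric_proj_closest i w.
rewrite (affine_proj_dot dot_norm _ _ (Cc i) (proj1 uP) wP)//.
by rewrite dotC -(affine_proj_dot dot_norm _ _ (Cc i) (proj1 wP) uP).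
Qed.

(** Both sides compare to the average of |P i u - c|^2, which equals the right
    one because P i u - c is orthogonal to u - P i u. *)
Lemma average_proj_norm2_le_dot u c :
  (forall i, affine_subspace (C i)) -> (forall i, C i c) ->
  `|T u - c| ^+ 2 <= dot (T u - c) (u - c).
Proof.
move=> Caff Cc; rewrite /T average_subr.
apply: le_trans (norm2_average_le _) _; rewrite dot_suml.
apply: ler_sum => i _; rewrite dotZl ler_wpM2l ?(ltW (lambda_gt0 i))//.
have uP := metric_proj_closest i u.
by rewrite (affine_proj_dot dot_norm _ _ (Cc i) (proj1 uP) uP)// dotxx.
Qed.

End AveragedProjections.

(** * Convergence of the iterates *)

Section AveragedProjectionSequence.
Context (R : realType) (U : completeNormedModType R)
  (dot : {dot U for (@idfun R)}) (dot_norm : induces_norm dot)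
  (N : nat) (C : 'I_N -> set U)
  (C_closed : forall i, closed (C i)) (C_convex : forall i, convex_set (C i))
  (lambda : 'I_N -> R) (lambda_gt0 : forall i, 0 < lambda i)
  (lambda_sum : \sum_(i < N) lambda i = 1)
  (C_meet : \bigcap_(i in [set: 'I_N]) C i !=set0)
  (u : nat -> U)
  (u_S : forall k, u k.+1 = \sum_(i < N) lambda i *: metric_proj (C i) (u k)).

Let fejer c k : (forall i, C i c) ->
  `|u k.+1 - c| ^+ 2 +
    \sum_(i < N) lambda i * `|u k - metric_proj (C i) (u k)| ^+ 2
  <= `|u k - c| ^+ 2.
Proof. by move=> Cc; rewrite u_S; exact: (average_proj_fejer dot_norm). Qed.

Lemma iter_dist_nonincreasing c : (forall i, C i c) ->
  {homo (fun k => `|u k - c|) : m n / (m <= n)%N >-> n <= m}.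
Proof.
move=> Cc; apply/nonincreasing_seqP => k.
rewrite -(ler_pXn2r (ltn0Sn 1)) ?nnegrE//; apply: le_trans (fejer k Cc).
rewrite lerDl; apply: sumr_ge0 => i _.
by rewrite mulr_ge0 ?sqr_ge0// (ltW (lambda_gt0 i)).
Qed.

Lemma iter_dist_cvg c : (forall i, C i c) -> cvgn (fun k => `|u k - c|).
Proof.
move=> Cc; apply: nonincreasing_is_cvgn; first exact: iter_dist_nonincreasing.
by exists 0 => _ [k _ <-].
Qed.

(** The weighted squared residual is at most the decrease of |u k - c|^2, the
    difference of consecutive terms of a convergent sequence. *)
Lemma iter_proj_dist_cvg0 i :
  `|u k - metric_proj (C i) (u k)| @[k --> \oo] --> 0.
Proof.
have [c Cc'] := C_meet; have {Cc'} Cc j : C j c by exact: Cc'.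
have /cvg_ex[/= l dl] := iter_dist_cvg Cc.
have d2l : `|u k - c| ^+ 2 @[k --> \oo] --> l ^+ 2 by exact: cvgM.
have d2lS : `|u k.+1 - c| ^+ 2 @[k --> \oo] --> l ^+ 2.
  by have := d2l; rewrite -(cvg_shiftS (fun k => `|u k - c| ^+ 2)).
have ub : (lambda i)^-1 * (`|u k - c| ^+ 2 - `|u k.+1 - c| ^+ 2) @[k --> \oo] --> 0.
  rewrite -[0](mulr0 (lambda i)^-1) -(subrr (l ^+ 2)).
  by apply: cvgMl_tmp; exact: cvgB.
have sq0 : `|u k - metric_proj (C i) (u k)| ^+ 2 @[k --> \oo] --> 0.
  apply: (squeeze_cvgr _ (cvg_cst 0) ub); apply: nearW => k.
  rewrite sqr_ge0/= ler_pdivlMl// lerBrDl; apply: le_trans (fejer k Cc).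
  rewrite lerD2l (bigD1 i)//= lerDl; apply: sumr_ge0 => j _.
  by rewrite mulr_ge0 ?sqr_ge0// (ltW (lambda_gt0 j)).
apply/cvgrPdist_lt => e e0.
have e2 : 0 < e ^+ 2 by rewrite exprn_gt0.
have [n _ nP] := cvgr0_norm_lt _ sq0 _ e2; exists n => // k /nP /=.
by rewrite sub0r normrN normr_id ger0_norm ?sqr_ge0// ltr_pXn2r ?nnegrE// ltW.
Qed.

Lemma iter_dot_cvg :
  exists2 z, (forall i, C i z) & forall y, dot (u k) y @[k --> \oo] --> dot z y.
Proof.
have [c Cc'] := C_meet; have {Cc'} Cc j : C j c by exact: Cc'.
apply: (@opial _ _ _ dot_norm _ _ _ _ (`|u 0%N - c| + `|c|)).
- move=> k; rewrite -[u k](subrK c); apply: le_trans (ler_normD _ _) _.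
  by rewrite lerD2r iter_dist_nonincreasing.
- by move=> d Cd; exact: iter_dist_cvg.
- move=> G z GU FG uz i.
  have GF := @ultra_proper _ _ GU.
  apply: (@weak_limit_closed_convex _ _ _ dot_norm (C i) _ G _ u
    (fun k => metric_proj (C i) (u k))) => //.
    move=> k.
    by have [] := metric_proj_closest dot_norm C_closed C_convex C_meet i (u k).
  by move=> A /(@iter_proj_dist_cvg0 i) /FG.
Qed.

(** Self-adjointness moves one application of the map from one argument to the
    other, so only the sum of the two indices matters. *)
Lemma iter_affine_dot_shift c j k :
  (forall i, affine_subspace (C i)) -> (forall i, C i c) ->
  dot (u (j + k)%N - c) (u 0%N - c) = dot (u j - c) (u k - c).
Proof.
move=> Caff Cc; elim: k j => [|k IHk] j; first by rewrite addn0.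
rewrite addnS -addSn IHk !u_S.
exact: (average_proj_selfadjoint dot_norm).
Qed.

(** With a (j + k) = <u j - c, u k - c> convergent to l from above, the square
    |u m - u n|^2 = a (2 m) - 2 a (m + n) + a (2 n) is at most
    (a m - l) + (a n - l). *)
Lemma iter_affine_cvg : (forall i, affine_subspace (C i)) -> cvgn u.
Proof.
move=> Caff; have [c Cc'] := C_meet; have {Cc'} Cc j : C j c by exact: Cc'.
pose a n := dot (u n - c) (u 0%N - c).
have aD j k : dot (u j - c) (u k - c) = a (j + k)%N.
  by rewrite -iter_affine_dot_shift.
have a2 j : `|u j - c| ^+ 2 = a (j + j)%N by rewrite -aD (dotxx dot_norm).
(* At an even index, Cauchy-Schwarz and |u (h + 1) - c| <= |u h - c|. *)
have a_even h : a (h + h).+1 <= a (h + h)%N.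
  rewrite -addSn -aD; apply: le_trans (dot_le dot_norm _ _) _.
  by rewrite -a2 expr2 ler_wpM2r// iter_dist_nonincreasing.
(* At an odd index, the lower bound |T u - c|^2 <= <T u - c, u - c>. *)
have a_odd h : a (h + h).+2 <= a (h + h).+1.
  rewrite -addnS -addSn -a2 -aD dotC u_S.
  exact: (average_proj_norm2_le_dot dot_norm).
have aS_le j : a j.+1 <= a j.
  rewrite -[j]odd_double_half -addnn; case: (odd j); first exact: a_odd.
  exact: a_even.
have a_noninc : {homo a : m n / (m <= n)%N >-> n <= m} by exact/nonincreasing_seqP.
have a_ge0 n : 0 <= a n.
  by apply: le_trans (a_noninc n (n + n)%N _); rewrite ?leq_addr// -a2 sqr_ge0.
have /cvg_ex[/= l al] : cvgn a.
  by apply: nonincreasing_is_cvgn => //; exists 0 => _ [k _ <-].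
have l_le n : l <= a n.
  apply: (cvgr_to_le al); exists n => // m /= nm; exact: a_noninc.
apply: (@cvgn_cauchy_bound _ _ _ (fun n => a n - l)).
  by rewrite -(subrr l); apply: cvgB => //; exact: cvg_cst.
move=> m n.
have -> : u m - u n = (u m - c) - (u n - c) by rewrite opprB addrA subrK.
rewrite (norm2B dot_norm) !a2 aD.
have := l_le (m + n)%N.
have := a_noninc m (m + m)%N (leq_addr _ _).
have := a_noninc n (n + n)%N (leq_addr _ _).
lra.
Qed.

End AveragedProjectionSequence.

Unset Implicit Arguments.

Theorem theorem2 (R : realType) (U : completeNormedModType R)
    (dot : {dot U for (@idfun R)}) (dot_norm : induces_norm dot)
    (N : nat) (C : 'I_N -> set U)
    (C_closed : forall i, closed (C i))
    (C_convex : forall i, convex_set (C i))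
    (lambda : 'I_N -> R)
    (lambda01 : forall i, 0 < lambda i < 1)
    (lambda_sum : \sum_(i < N) lambda i = 1)
    (u0 : U) (u : nat -> U)
    (u_0 : u 0%N = u0)
    (u_S : forall k, u k.+1 = \sum_(i < N) lambda i *: metric_proj (C i) (u k))
    (C_meet : \bigcap_(i in [set: 'I_N]) C i !=set0) :
  exists ustar : U,
    [/\ (\bigcap_(i in [set: 'I_N]) C i) ustar,
        weakly_cvg u ustar &
        (forall i, affine_subspace (C i)) -> u k @[k --> \oo] --> ustar].
Proof.
have lambda_gt0 i : 0 < lambda i by have /andP[] := lambda01 i.
have [z Cz uz] := iter_dot_cvg dot_norm C_closed C_convex lambda_gt0
  lambda_sum C_meet u_S.
exists z; split => //; first exact: (weakly_cvg_dot dot_norm).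
move=> Caff.
have /cvg_ex[/= w uw] := iter_affine_cvg dot_norm C_closed C_convex lambda_gt0
  lambda_sum C_meet u_S Caff.
suff -> : z = w by [].
have zw y : dot z y = dot w y.
  by apply: (cvg_unique (@norm_hausdorff _ _) (uz y)); exact: (cvg_dotl dot_norm).
apply/eqP; rewrite -subr_eq0 -normr_eq0 -sqrf_eq0 -(dotxx dot_norm) dotBl zw.
by rewrite subrr.
Qed.
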